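(* For any hypergraph $H$ and any vertex $v\in V(H)$, $b_L(H)-1\le b_L(H\setminus\{v\})\le b_L(H)$.
   Context: A hypergraph $H$ consists of a finite vertex set $V(H)$ and a finite collection $E(H)$ of nonempty subsets of $V(H)$. Lazy burning: a set $B\subseteq V(H)$ is burned initially; in each subsequent round every unburned vertex $v$ for which some hyperedge $h\ni v$ has $h\setminus\{v\}$ entirely burned becomes burned. $B$ is a lazy burning set if eventually all vertices burn; $b_L(H)$ is the minimum size of a lazy burning set. For $U\subseteq V(H)$, $H\setminus U$ is the hypergraph with vertex set $V(H)\setminus U$ and hyperedges $\{h\setminus U: h\in E(H),\ h\setminus U\neq\emptyset\}$. *)

(* Defs.v *)
From mathcomp Require Import all_boot.

Set Implicit Arguments.
Unset Strict Implicit.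
Unset Printing Implicit Defensive.

(* The vertex set is an arbitrary subset of a finite ambient type [T], so that
   vertex deletion stays within the same type. *)
Record hypergraph (T : finType) := Hypergraph {
  vertices : {set T};
  edges : {set {set T}};
  edges_nonempty : forall h, h \in edges -> h != set0;
  edges_sub : forall h, h \in edges -> h \subset vertices
}.

Section Deletion.
Variables (T : finType) (H : hypergraph T) (U : {set T}).

Definition del_edges : {set {set T}} :=
  [set h :\: U | h in edges H & h :\: U != set0].

Fact del_edges_nonempty h : h \in del_edges -> h != set0.
Proof. by case/imsetP=> h' /[!inE] /andP[_ ?] ->. Qed.

Fact del_edges_sub h : h \in del_edges -> h \subset vertices H :\: U.
Proof.
by case/imsetP=> h' /[!inE] /andP[/edges_sub h'V _] ->; exact: setSD.
Qed.

Definition del_vertices : hypergraph T :=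
  Hypergraph del_edges_nonempty del_edges_sub.

End Deletion.

Section LazyBurning.
Variables (T : finType) (H : hypergraph T).

(* For a singleton hyperedge the condition is vacuous: its vertex burns
   spontaneously, so the empty set may be a lazy burning set. *)
Definition burn_round (X : {set T}) : {set T} :=
  X :|: [set v in vertices H |
          [exists h in edges H, (v \in h) && (h :\ v \subset X)]].

Definition lazy_burning_set (B : {set T}) : Prop :=
  B \subset vertices H /\ exists n, iter n burn_round B = vertices H.

(* The process is stationary after at most #|T| rounds, which makes
   [lazy_burning_set] decidable. *)
Definition lazy_burning_setb (B : {set T}) : bool :=
  (B \subset vertices H) && (iter #|T| burn_round B == vertices H).

Lemma burn_round_sub (X : {set T}) : X \subset burn_round X.
Proof. exact: subsetUl. Qed.

Lemma iter_burn_round_sub m n (B : {set T}) :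
  m <= n -> iter m burn_round B \subset iter n burn_round B.
Proof.
move=> /subnK <-; elim: (n - m) => // k IHk.
by rewrite addSn iterS (subset_trans IHk) ?burn_round_sub.
Qed.

Lemma iter_burn_round_sub_vertices n (B : {set T}) :
  B \subset vertices H -> iter n burn_round B \subset vertices H.
Proof.
move=> BV; elim: n => //= n IHn; rewrite subUset IHn /=.
by apply/subsetP=> v /[!inE] /andP[].
Qed.

Lemma iter_burn_round_stationary n (B : {set T}) :
  iter n burn_round B \subset iter #|T| burn_round B.
Proof.
have [k lekT fixk] : exists2 k, k <= #|T| &
    burn_round (iter k burn_round B) = iter k burn_round B.
  suff grow k : (exists2 j, j < k &
      burn_round (iter j burn_round B) = iter j burn_round B) \/
      k <= #|iter k burn_round B|.
    have [[j ltj fixj]|] := grow #|T|.+1; first by exists j.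
    by move/leq_trans/(_ (max_card _)); rewrite ltnn.
  elim: k => [|k [[j ltjk fixj]|IHk]]; first by right.
    by left; exists j => //; exact: ltnW.
  have [fixk|nfix] := eqVneq (burn_round (iter k burn_round B))
                             (iter k burn_round B); first by left; exists k.
  right; apply: leq_ltn_trans IHk _; apply: proper_card.
  by rewrite properEneq eq_sym nfix burn_round_sub.
have stat m : iter (m + k) burn_round B = iter k burn_round B.
  by elim: m => // m IHm; rewrite addSn iterS IHm.
apply: subset_trans (iter_burn_round_sub B (leq_addr k n)) _.
by rewrite stat; exact: iter_burn_round_sub.
Qed.

Lemma lazy_burning_setP B : reflect (lazy_burning_set B) (lazy_burning_setb B).
Proof.
apply: (iffP andP) => [[BV /eqP burnt]|[BV [n burnt]]]; split=> //.
  by exists #|T|.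
rewrite eqEsubset iter_burn_round_sub_vertices //=.
by rewrite -burnt iter_burn_round_stationary.
Qed.

Lemma lazy_burning_set_vertices : lazy_burning_set (vertices H).
Proof. by split=> //; exists 0. Qed.

Definition lazy_burning_number : nat :=
  #|[arg min_(B < vertices H | lazy_burning_setb B) #|B|]|.

Lemma lazy_burning_numberP :
  (exists2 B, lazy_burning_set B & #|B| = lazy_burning_number) /\
  (forall B, lazy_burning_set B -> lazy_burning_number <= #|B|).
Proof.
rewrite /lazy_burning_number; case: arg_minnP => [|B /lazy_burning_setP LB minB].
  exact/lazy_burning_setP/lazy_burning_set_vertices.
by split=> [|C /lazy_burning_setP /minB //]; exists B.
Qed.

End LazyBurning.

(* Main.v *)
(* If [B] burns [H], then [B :\: U] burns [H \ U]: away from [U], every vertex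
   catches fire in [H \ U] no later than it does in [H]. Conversely, if [B] burns
   [H \ U], then [B :|: U] burns [H]: once [U] is burned, a hyperedge [h] fires
   as soon as [h :\: U] does. *)
Require Import Defs.
From mathcomp Require Import all_boot.

Set Implicit Arguments.
Unset Strict Implicit.
Unset Printing Implicit Defensive.

(** Monotonicity is what lets the one-round comparisons below be iterated by induction on the number
    of rounds. *)
Lemma burn_roundS (T : finType) (H : hypergraph T) (X Y : {set T}) :
  X \subset Y -> burn_round H X \subset burn_round H Y.
Proof.
move=> sXY; apply/setUSS/subsetP=> // u /[!inE] /andP[-> /existsP[h]].
case/and3P=> hE uh hX; apply/existsP; exists h.
by rewrite hE uh (subset_trans hX).
Qed.

Section DeletionBurning.
Variables (T : finType) (H : hypergraph T).
Implicit Types B U X Y : {set T}.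

(** If [h] makes [u] burn and [u] lies outside [U], then [h :\: U] still contains [u], so it is
    nonempty and survives the deletion. *)
Lemma burn_round_delD U X :
  burn_round H X :\: U \subset burn_round (del_vertices H U) (X :\: U).
Proof.
apply/subsetP=> u /[!inE] /andP[uU]; rewrite uU /=.
case/orP=> [-> //|/andP[-> /existsP[h /and3P[hE uh hX]]]]; apply/orP; right.
have uhU : u \in h :\: U by rewrite inE uU.
apply/existsP; exists (h :\: U); rewrite uhU /=; apply/andP; split.
  by apply/imsetP; exists h; rewrite // inE hE; apply/set0Pn; exists u.
(* Removing [U] and removing [u] commute, so the inclusion is [hX] with [U] removed from both
   sides. *)
by rewrite setDDl setUC -setDDl setSD.
Qed.

Lemma burn_round_delU U X :
  burn_round (del_vertices H U) X :|: U \subset burn_round H (X :|: U).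
Proof.
apply/subsetP=> u /[!inE].
case/orP=> [/orP[-> //|/andP[/andP[_ ->]]]|->]; last by rewrite orbT.
case/existsP=> _ /and3P[/imsetP[h /[!inE] /andP[hE _] ->] /[!inE] /andP[_ uh] hX].
apply/orP; right; apply/existsP; exists h; rewrite hE uh /=.
(* Vertices of [h] in [U] are already burned; the others are covered by [hX], after swapping the two
   removals. *)
by rewrite setUC -subDset setDDl setUC -setDDl.
Qed.

Lemma iter_burn_round_delD U B n :
  iter n (burn_round H) B :\: U
    \subset iter n (burn_round (del_vertices H U)) (B :\: U).
Proof.
elim: n => //= n IHn; apply: subset_trans (burn_round_delD _ _) _.
exact: burn_roundS.
Qed.

Lemma iter_burn_round_delU U B n :
  iter n (burn_round (del_vertices H U)) B :|: U
    \subset iter n (burn_round H) (B :|: U).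
Proof.
elim: n => //= n IHn; apply: subset_trans (burn_round_delU _ _) _.
exact: burn_roundS.
Qed.

Lemma lazy_burning_set_delD U B :
  lazy_burning_set H B -> lazy_burning_set (del_vertices H U) (B :\: U).
Proof.
case=> BV [n burnt]; have BUV := setSD U BV; split=> //; exists n.
apply/eqP; rewrite eqEsubset iter_burn_round_sub_vertices //=.
by rewrite -burnt iter_burn_round_delD.
Qed.

Lemma lazy_burning_set_delU U B : U \subset vertices H ->
  lazy_burning_set (del_vertices H U) B -> lazy_burning_set H (B :|: U).
Proof.
move=> UV [BV [n burnt]]; have BUV : B :|: U \subset vertices H.
  by rewrite subUset UV andbT (subset_trans BV) ?subsetDl.
split=> //; exists n.
apply/eqP; rewrite eqEsubset iter_burn_round_sub_vertices //=.
(* After [n] rounds the deletion has burned [vertices H :\: U]; adding [U] back covers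
   [vertices H]. *)
apply: subset_trans (iter_burn_round_delU _ _ _); rewrite burnt.
by rewrite setUC -subDset.
Qed.

Lemma lazy_burning_number_del_le U :
  lazy_burning_number (del_vertices H U) <= lazy_burning_number H.
Proof.
have [[B LB <-] _] := lazy_burning_numberP H.
have [_ /(_ _ (lazy_burning_set_delD U LB))] :=
  lazy_burning_numberP (del_vertices H U).
by move/leq_trans; apply; rewrite subset_leq_card ?subsetDl.
Qed.

Lemma lazy_burning_number_le_del U : U \subset vertices H ->
  lazy_burning_number H <= lazy_burning_number (del_vertices H U) + #|U|.
Proof.
move=> UV; have [[B LB <-] _] := lazy_burning_numberP (del_vertices H U).
have [_ /(_ _ (lazy_burning_set_delU UV LB))] := lazy_burning_numberP H.
by move/leq_trans; apply; rewrite cardsU leq_subr.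
Qed.

End DeletionBurning.

Theorem theorem3p8 (T : finType) (H : hypergraph T) (v : T)
    (hv : v \in vertices H) :
  lazy_burning_number H - 1 <= lazy_burning_number (del_vertices H [set v])
    /\ lazy_burning_number (del_vertices H [set v]) <= lazy_burning_number H.
Proof.
split; last exact: lazy_burning_number_del_le.
(* The truncated subtraction becomes an addition, and its [1] is read as the cardinality of
   [[set v]]. *)
by rewrite leq_subLR addnC -(cards1 v) lazy_burning_number_le_del ?sub1set.
Qed.
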